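(* For $\lambda>0$, let $u_{\lambda}\in\mathcal{C}^2([0,1])$ be the unique solution of $$-u_{\lambda}''(r)=\rho_\lambda(r):=\frac{\lambda\, e^{-u_{\lambda}(r)}}{\int_0^1 e^{-u_{\lambda}(s)}\,\mathrm{d}s},\quad r\in(0,1),\qquad u_{\lambda}(0)=u_{\lambda}'(0)=0.$$ Then, as $\lambda\to\infty$, the following hold. (a) For any compact subset $K$ (independent of $\lambda$) of $[0,1)$, $$\rho_\lambda(r)=\frac{\pi^2}{2}\sec^2\left(\frac\pi2r\right)-\frac1\lambda\left[2\pi^2\sec^2\left(\frac\pi2r\right)+\pi^3r\sec^2\left(\frac\pi2r\right)\tan\left(\frac\pi2r\right)\right](1+o_\lambda)$$ uniformly for $r\in K$. (b) For constants $p,\alpha>0$ independent of $\lambda$ and $r_{p,\alpha}^\lambda=1-\frac{p}{\lambda^\alpha}$ (with $\lambda$ large enough that $r_{p,\alpha}^\lambda\in(0,1)$), $$\rho_\lambda(r_{p,\alpha}^\lambda)=\begin{cases}\dfrac{\lambda^2}{2}(1+o_\lambda)&\text{if }\alpha\in(1,\infty),\\[2mm]\dfrac{2\lambda^2}{(p+2)^2}(1+o_\lambda)&\text{if }\alpha=1,\\[2mm]\dfrac{2\lambda^{2\alpha}}{p^2}(1+o_\lambda)&\text{if }\alpha\in(0,1).\end{cases}$$ (c) For any continuous function $h:[0,1]\to\mathbb{R}$ independent of $\lambda$, $$\lim_{\lambda\to\infty}\int_0^1\frac{\rho_\lambda(r)}{\lambda}h(r)\,\mathrm{d}r=h(1)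\quad\text{and}\quad\lim_{\lambda\to\infty}\int_0^1\frac{(u_\lambda'(r))^2}{2\lambda}h(r)\,\mathrm{d}r=h(1).$$
   Context: $o_\lambda$ denotes a quantity (possibly different at each occurrence, allowed to depend on the fixed constants $p,\alpha$) tending to $0$ as $\lambda\to\infty$; in (a) it may depend on $r\in K$ but tends to $0$ uniformly in $r\in K$. Existence and uniqueness of the $\mathcal{C}^2([0,1])$ solution $u_\lambda$ for every $\lambda>0$ is a known fact and is taken as given. *)

(* Defs.v *)
From Stdlib Require Import Reals.
From Coquelicot Require Import Coquelicot.
Open Scope R_scope.

Definition I01 (r : R) : Prop := 0 <= r <= 1.

Definition sec (x : R) : R := / cos x.

(* u is of class C^2 on [0,1] with first and second derivatives du and ddu.
   Derivatives and continuity are relative to [0,1], hence one-sided at 0 and 1,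
   and nothing is asked of the values outside [0,1]. *)
Definition is_C2_01 (u du ddu : R -> R) : Prop :=
  (forall r, I01 r -> D_in u du I01 r) /\
  (forall r, I01 r -> D_in du ddu I01 r) /\
  continuous_on I01 ddu.

Definition rho (lambda : R) (u : R -> R) (r : R) : R :=
  lambda * exp (- u r) / RInt (fun s => exp (- u s)) 0 1.

Definition is_solution (lambda : R) (u du ddu : R -> R) : Prop :=
  is_C2_01 u du ddu /\
  (forall r, 0 < r < 1 -> - ddu r = rho lambda u r) /\
  u 0 = 0 /\ du 0 = 0.

Definition unif_vanishing (K : R -> Prop) (o : R -> R -> R) : Prop :=
  forall eps, 0 < eps ->
    Rbar_locally p_infty (fun lambda => forall r, K r -> Rabs (o lambda r) < eps).

Definition vanishing (o : R -> R) : Prop := is_lim o p_infty 0.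

(* Main.v *)
Require Import Defs.
From Stdlib Require Import Reals Lra Psatz.
From Coquelicot Require Import Coquelicot.
Open Scope R_scope.

(* With [2 * m ^ 2 = lambda / J], [J] the integral of [exp (- u)], the function
   [exp (u / 2)] solves [w'' = - m ^ 2 * w], [w 0 = 1], [w' 0 = 0], hence equals
   [cos (m * r)].  Positivity forces [m < PI / 2]; then
   [rho = 2 * m ^ 2 / cos (m * r) ^ 2], [u' = - 2 * m * tan (m * r)], and integrating
   gives the dispersion relation [2 * m * tan m = lambda].  It follows that
   [PI / 2 - m = PI / lambda + O(1 / lambda ^ 2)].  Part (a) is the first-order
   Taylor expansion in [m] at [PI / 2].  For (b),
   [cos (m * r) = sin (PI / 2 - m * r)] and
   [PI / 2 - m * r = (PI / 2 - m) + m * p / lambda ^ alpha], so [alpha] decides which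
   term dominates.  For (c), [rho / lambda] is a probability density which is
   [O(1 / lambda)] away from [1], and [u' ^ 2 / 2 = rho - 2 * m ^ 2]. *)

(** * Passing from calculus relative to [[0,1]] to calculus on the line *)

(** Projection onto [[0,1]]. Precomposing with it extends a function controlled only on [[0,1]] to
    one continuous everywhere, whatever its values outside. *)
Definition clamp (r : R) : R := Rmax 0 (Rmin 1 r).

Lemma clamp_I01 (r : R) : I01 (clamp r).
Proof.
  unfold I01, clamp, Rmax, Rmin; repeat destruct Rle_dec; lra.
Qed.

Lemma clamp_id (r : R) : I01 r -> clamp r = r.
Proof.
  unfold I01, clamp, Rmax, Rmin; repeat destruct Rle_dec; lra.
Qed.

Lemma clamp_lipschitz (x y : R) : Rabs (clamp y - clamp x) <= Rabs (y - x).
Proof.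
  unfold clamp, Rmax, Rmin, Rabs; repeat destruct Rle_dec;
    repeat destruct Rcase_abs; lra.
Qed.

(** As [clamp] is 1-Lipschitz with values in [[0,1]], the radius given by relative continuity at
    [clamp x] works unchanged. *)
Lemma continuous_clamp (f : R -> R) (x : R) :
  continuous_on I01 f -> continuous (fun r => f (clamp r)) x.
Proof.
  intros Hf.
  apply filterlim_comp with (2 := Hf (clamp x) (clamp_I01 x)).
  intros P [e He]; exists e; intros y Hy.
  apply He; [ | apply clamp_I01 ].
  apply Rle_lt_trans with (2 := Hy); apply clamp_lipschitz.
Qed.

Lemma D_in_continuous_on (f df : R -> R) :
  (forall r, I01 r -> D_in f df I01 r) -> continuous_on I01 f.
Proof.
  intros Hf x Hx P [e He].
  destruct (cont_deriv f df I01 x (Hf x Hx) e (cond_pos e)) as [d [Hd H]].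
  exists (mkposreal d Hd); intros y Hy Iy.
  (* The limit supplied by [cont_deriv] ranges over points different from [x] only. *)
  destruct (Req_dec x y) as [<- | Hn].
  - apply He, ball_center.
  - apply He, H; exact (conj (conj Iy Hn) Hy).
Qed.

Lemma D_in_is_derive (f df : R -> R) (r : R) :
  0 < r < 1 -> D_in f df I01 r -> is_derive f r (df r).
Proof.
  intros Hr H; apply is_derive_Reals; intros e He.
  destruct (H e He) as [d [Hd Hd']].
  (* This radius keeps [r + h] inside [[0,1]], where relative and ordinary difference quotients
     agree. *)
  assert (Hm : 0 < Rmin d (Rmin r (1 - r))) by (repeat apply Rmin_pos; lra).
  exists (mkposreal _ Hm); intros h Hh0 Hh; simpl in Hh.
  assert (H1 := Rmin_l d (Rmin r (1 - r))).
  assert (H2 := Rmin_r d (Rmin r (1 - r))).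
  assert (H3 := Rmin_l r (1 - r)); assert (H4 := Rmin_r r (1 - r)).
  assert (Hb : -(r) < h < 1 - r) by (unfold Rabs in Hh; destruct Rcase_abs in Hh; lra).
  specialize (Hd' (r + h)); simpl in Hd'; unfold Rdist, D_x, I01 in Hd'.
  replace (r + h - r) with h in Hd' by ring.
  apply Hd'; repeat split; lra.
Qed.

Lemma is_derive_clamp (f df : R -> R) (r : R) :
  0 < r < 1 -> is_derive f r (df r) -> is_derive (fun s => f (clamp s)) r (df r).
Proof.
  intros Hr H; apply is_derive_ext_loc with (2 := H).
  assert (Hm : 0 < Rmin r (1 - r)) by (apply Rmin_pos; lra).
  exists (mkposreal _ Hm); intros y Hy.
  change (Rabs (y - r) < Rmin r (1 - r)) in Hy.
  assert (H3 := Rmin_l r (1 - r)); assert (H4 := Rmin_r r (1 - r)).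
  rewrite clamp_id; [reflexivity|].
  unfold I01; unfold Rabs in Hy; destruct Rcase_abs in Hy; lra.
Qed.

(** * Explicit solution of the local equation *)

Lemma zero_derive_const (f : R -> R) :
  (forall r, continuous f r) -> (forall r, 0 < r < 1 -> is_derive f r 0) ->
  forall r, I01 r -> f r = f 0.
Proof.
  intros Hc Hd r [H0 H1].
  destruct (MVT_gen f 0 r (fun _ => 0)) as [c [_ Hc']].
  - rewrite Rmin_left, Rmax_right by lra; intros x Hx; apply Hd; lra.
  - intros x _; apply continuity_pt_filterlim, Hc.
  - lra.
Qed.

Ltac cont :=
  repeat first
    [ assumption
    | match goal with H : forall r, continuous ?f r |- continuous ?f _ => apply H end
    | apply continuous_const
    | apply continuous_id
    | match goal with |- continuous (fun x => @?f x + @?g x) _ =>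
        apply (@continuous_plus _ R_AbsRing R_NormedModule f g) end
    | match goal with |- continuous (fun x => @?f x - @?g x) _ =>
        apply (@continuous_minus _ R_AbsRing R_NormedModule f g) end
    | match goal with |- continuous (fun x => @?f x * @?g x) _ =>
        apply (@continuous_mult _ R_AbsRing f g) end
    | match goal with |- continuous (fun x => exp (@?f x)) _ =>
        apply (continuous_comp f exp); [ | apply continuous_exp ] end
    | match goal with |- continuous (fun x => cos (@?f x)) _ =>
        apply (continuous_comp f cos); [ | apply continuous_cos ] end
    | match goal with |- continuous (fun x => sin (@?f x)) _ =>
        apply (continuous_comp f sin); [ | apply continuous_sin ] end ].

(* [exp (U / 2)] solves the linear equation [w'' = - m ^ 2 * w], [w 0 = 1],
   [w' 0 = 0]; this uses the first integral [V ^ 2 = 4 * m ^ 2 * (exp (- U) - 1)]. *)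
Lemma liouville_solution (m : R) (U V : R -> R) :
  0 < m ->
  (forall r, continuous U r) -> (forall r, continuous V r) ->
  (forall r, 0 < r < 1 -> is_derive U r (V r)) ->
  (forall r, 0 < r < 1 -> is_derive V r (- (2 * m ^ 2 * exp (- U r)))) ->
  U 0 = 0 -> V 0 = 0 ->
  forall r, I01 r ->
    exp (U r * / 2) = cos (m * r) /\ V r * exp (U r * / 2) = - (2 * m * sin (m * r)).
Proof.
  intros Hm CU CV DU DV U0 V0.
  (* Conservation of energy. The forms [- 1 * U r] and [U r * / 2] are products because [cont]
     decomposes products but not opposites or quotients. *)
  assert (E : forall r, I01 r -> V r * V r - 4 * m ^ 2 * exp (- 1 * U r) = - (4 * m ^ 2)).
  { intros r Hr.
    rewrite (zero_derive_const (fun r => V r * V r - 4 * m ^ 2 * exp (- 1 * U r))); auto.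
    - rewrite U0, V0; replace (- 1 * 0) with 0 by ring; rewrite exp_0; ring.
    - intros s; cont.
    - intros s Hs; assert (HU := DU s Hs); assert (HV := DV s Hs).
      auto_derive.
      + repeat split; eexists; eassumption.
      + assert (HU' : Derive (fun x : R => U x) s = V s) by exact (is_derive_unique _ _ _ HU).
        assert (HV' := is_derive_unique _ _ _ HV).
        change (Derive (fun x : R => V x) s = - (2 * m ^ 2 * exp (- U s))) in HV'.
        rewrite HU', HV'.
        replace (-1 * U s) with (- U s) by ring; ring. }
  (* For [w = exp (U / 2)] the left side is [4 * w''], so this is the linear equation
     [w'' = - m ^ 2 * w]. *)
  assert (W : forall r, I01 r ->
    exp (U r * / 2) * (V r * V r - 4 * m ^ 2 * exp (- 1 * U r)) =
    exp (U r * / 2) * - (4 * m ^ 2)).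
  { intros r Hr; rewrite E by assumption; reflexivity. }
  (* Since [w' = V * w / 2], the facts [G1] and [G2] say that the vector [(w, w' / m)], rotated by
     the angle [m * r], keeps its initial value [(1, 0)]. This replaces a uniqueness theorem for the
     linear equation. *)
  assert (G1 : forall r, I01 r ->
    exp (U r * / 2) * cos (m * r) - (V r * exp (U r * / 2)) * (sin (m * r) * / (2 * m)) = 1).
  { intros r Hr.
    rewrite (zero_derive_const (fun r => exp (U r * / 2) * cos (m * r) -
      (V r * exp (U r * / 2)) * (sin (m * r) * / (2 * m)))); auto.
    - rewrite U0, V0, Rmult_0_r; replace (0 * / 2) with 0 by ring; rewrite exp_0, cos_0; ring.
    - intros s; cont.
    - intros s Hs; assert (HU := DU s Hs); assert (HV := DV s Hs).
      assert (Ws := W s ltac:(unfold I01; lra)).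
      auto_derive.
      + repeat split; eexists; eassumption.
      + assert (HU' : Derive (fun x : R => U x) s = V s) by exact (is_derive_unique _ _ _ HU).
        assert (HV' := is_derive_unique _ _ _ HV).
        change (Derive (fun x : R => V x) s = - (2 * m ^ 2 * exp (- U s))) in HV'.
        rewrite HU', HV'.
        replace (-1 * U s) with (- U s) in Ws by ring.
        match goal with |- ?L = 0 =>
          replace L with (- (sin (m * s) * / (4 * m)) *
            (exp (U s * / 2) * (V s * V s - 4 * m ^ 2 * exp (- U s)) +
             exp (U s * / 2) * (4 * m ^ 2))) by (field; lra) end.
        rewrite Ws; ring. }
  assert (G2 : forall r, I01 r ->
    exp (U r * / 2) * sin (m * r) + (V r * exp (U r * / 2)) * (cos (m * r) * / (2 * m)) = 0).
  { intros r Hr.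
    rewrite (zero_derive_const (fun r => exp (U r * / 2) * sin (m * r) +
      (V r * exp (U r * / 2)) * (cos (m * r) * / (2 * m)))); auto.
    - rewrite U0, V0, Rmult_0_r; replace (0 * / 2) with 0 by ring; rewrite sin_0; ring.
    - intros s; cont.
    - intros s Hs; assert (HU := DU s Hs); assert (HV := DV s Hs).
      assert (Ws := W s ltac:(unfold I01; lra)).
      auto_derive.
      + repeat split; eexists; eassumption.
      + assert (HU' : Derive (fun x : R => U x) s = V s) by exact (is_derive_unique _ _ _ HU).
        assert (HV' := is_derive_unique _ _ _ HV).
        change (Derive (fun x : R => V x) s = - (2 * m ^ 2 * exp (- U s))) in HV'.
        rewrite HU', HV'.
        replace (-1 * U s) with (- U s) in Ws by ring.
        match goal with |- ?L = 0 =>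
          replace L with ((cos (m * s) * / (4 * m)) *
            (exp (U s * / 2) * (V s * V s - 4 * m ^ 2 * exp (- U s)) +
             exp (U s * / 2) * (4 * m ^ 2))) by (field; lra) end.
        rewrite Ws; ring. }
  intros r Hr; specialize (G1 r Hr); specialize (G2 r Hr).
  assert (T := sin2_cos2 (m * r)); unfold Rsqr in T.
  set (w := exp (U r * / 2)) in *; set (s := sin (m * r)) in *; set (c := cos (m * r)) in *.
  set (z := V r * w) in *.
  (* Rotating back, by [sin ^ 2 + cos ^ 2 = 1], recovers [w] and [z = 2 * w']. *)
  split.
  - transitivity (w * (s * s + c * c)); [rewrite T; ring|].
    transitivity (c * (w * c - z * (s * / (2 * m))) + s * (w * s + z * (c * / (2 * m)))); [ring|].
    rewrite G1, G2; ring.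
  - transitivity (z * (s * s + c * c)); [rewrite T; ring|].
    transitivity (2 * m * (c * (w * s + z * (c * / (2 * m))) - s * (w * c - z * (s * / (2 * m))))).
    + field; lra.
    + rewrite G1, G2; ring.
Qed.

(** * Range of the frequency and the dispersion relation *)

(** If [m >= PI / 2], the point [PI / 2 / m] lies in [[0,1]] and the cosine vanishes there. *)
Lemma lt_PI2_of_cos_pos (m : R) :
  0 < m -> (forall r, I01 r -> 0 < cos (m * r)) -> m < PI / 2.
Proof.
  intros Hm H; destruct (Rlt_le_dec m (PI / 2)) as [|Hle]; [assumption|].
  assert (P := PI_RGT_0).
  assert (H0 := H (PI / 2 / m)).
  replace (m * (PI / 2 / m)) with (PI / 2) in H0 by (field; lra).
  rewrite cos_PI2 in H0; destruct (Rlt_irrefl 0); apply H0; split.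
  - apply Rlt_le, Rdiv_lt_0_compat; lra.
  - apply Rle_div_l; lra.
Qed.

Lemma cos_pos_lt_PI2 (m r : R) : 0 < m < PI / 2 -> I01 r -> 0 < cos (m * r).
Proof.
  intros Hm [H0 H1]; apply cos_gt_0; nra.
Qed.

Lemma is_derive_tan_scal (m r : R) :
  m <> 0 -> cos (m * r) <> 0 ->
  is_derive (fun s => tan (m * s) / m) r (/ cos (m * r) ^ 2).
Proof.
  intros Hm Hc; unfold tan; auto_derive.
  - repeat split; auto.
  - assert (T := sin2_cos2 (m * r)); unfold Rsqr in T.
    field_simplify_eq; auto.
    replace (1 * m) with m by ring. nra.
Qed.

Lemma continuous_sec2 (a m r : R) :
  cos (m * r) <> 0 -> continuous (fun s => a / cos (m * s) ^ 2) r.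
Proof.
  intros Hc; apply (ex_derive_continuous (fun s => a / cos (m * s) ^ 2)); auto_derive.
  exact (pow_nonzero _ 2 Hc).
Qed.

Lemma is_RInt_sec2 (a m : R) :
  0 < m < PI / 2 -> is_RInt (fun s => a / cos (m * s) ^ 2) 0 1 (a * tan m / m).
Proof.
  intros Hm.
  assert (H : is_RInt (fun s => a / cos (m * s) ^ 2) 0 1
    (minus (a * (tan (m * 1) / m)) (a * (tan (m * 0) / m)))).
  { apply (is_RInt_derive (fun s => a * (tan (m * s) / m))); rewrite Rmin_left, Rmax_right by lra;
      intros x Hx; assert (Hc := cos_pos_lt_PI2 m x Hm Hx).
    - apply (is_derive_scal (fun s => tan (m * s) / m)), is_derive_tan_scal; lra.
    - apply continuous_sec2; lra. }
  replace (a * tan m / m) with (minus (a * (tan (m * 1) / m)) (a * (tan (m * 0) / m))); [exact H|].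
  rewrite Rmult_1_r, Rmult_0_r, tan_0; unfold minus, plus, opp; simpl; field; lra.
Qed.

(* [u 0 = 0] gives [rho 0 = 2 * m ^ 2] for the frequency [m] of the solution. *)
Definition freq (lambda : R) (u : R -> R) : R := sqrt (rho lambda u 0 / 2).

(** The nonlocal term enters only through the number [J]. With [J] frozen the equation is the local
    one solved above, and computing [J] back from that solution gives the dispersion relation. *)
Lemma solution_formula (lambda : R) (u du ddu : R -> R) :
  0 < lambda -> is_solution lambda u du ddu ->
  let m := freq lambda u in
  0 < m < PI / 2 /\ 2 * m * tan m = lambda /\
  (forall r, I01 r -> rho lambda u r = 2 * m ^ 2 / cos (m * r) ^ 2) /\
  (forall r, I01 r -> du r = - (2 * m * tan (m * r))).
Proof.
  intros Hl [[H1 [H2 _]] [H3 [H4 H5]]] m.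
  set (U := fun r => u (clamp r)); set (V := fun r => du (clamp r)).
  assert (CU : forall r, continuous U r).
  { intros r; apply continuous_clamp, (D_in_continuous_on u du), H1. }
  assert (CV : forall r, continuous V r).
  { intros r; apply continuous_clamp, (D_in_continuous_on du ddu), H2. }
  set (J := RInt (fun s => exp (- u s)) 0 1).
  assert (HJ : 0 < J).
  { unfold J; rewrite (RInt_ext _ (fun s => exp (-1 * U s))).
    - apply RInt_gt_0; [lra | intros; apply exp_pos |].
      intros r _; cont.
    - rewrite Rmin_left, Rmax_right by lra; intros x Hx; unfold U.
      rewrite clamp_id by (unfold I01; lra); f_equal; ring. }
  assert (Hrho : forall r, rho lambda u r = lambda / J * exp (- u r)).
  { intros r; unfold rho; fold J; field; lra. }
  assert (HA : 0 < lambda / J) by (apply Rdiv_lt_0_compat; lra).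
  (* Evaluates the density at [0], where [u 0 = 0] makes the exponential equal to [1]. *)
  assert (Hm2 : 2 * m ^ 2 = lambda / J).
  { unfold m, freq; rewrite <- Rsqr_pow2, Rsqr_sqrt, Hrho, H4, Ropp_0, exp_0; [field; lra|].
    rewrite Hrho, H4, Ropp_0, exp_0; lra. }
  assert (Hm : 0 < m).
  { apply sqrt_lt_R0; rewrite Hrho, H4, Ropp_0, exp_0; lra. }
  assert (HS : forall r, I01 r ->
    exp (U r * / 2) = cos (m * r) /\ V r * exp (U r * / 2) = - (2 * m * sin (m * r))).
  { apply liouville_solution; auto.
    - intros r Hr.
      assert (V r = du r) as -> by (unfold V; rewrite clamp_id; auto; unfold I01; lra).
      apply is_derive_clamp, D_in_is_derive, H1; auto; unfold I01; lra.
    - intros r Hr.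
      assert (- (2 * m ^ 2 * exp (- U r)) = ddu r) as ->.
      { unfold U; rewrite clamp_id by (unfold I01; lra).
        rewrite Hm2, <- Hrho, <- H3 by assumption; ring. }
      apply is_derive_clamp, D_in_is_derive, H2; auto; unfold I01; lra.
    - unfold U; rewrite clamp_id; auto; unfold I01; lra.
    - unfold V; rewrite clamp_id; auto; unfold I01; lra. }
  (* The cosine equals an exponential on [[0,1]], which is what forces [m < PI / 2]. *)
  assert (Hcos : forall r, I01 r -> 0 < cos (m * r)).
  { intros r Hr; rewrite <- (proj1 (HS r Hr)); apply exp_pos. }
  assert (Hlt : m < PI / 2) by (apply lt_PI2_of_cos_pos; auto).
  assert (Hexp : forall r, I01 r -> exp (- u r) = 1 / cos (m * r) ^ 2).
  { intros r Hr; rewrite <- (proj1 (HS r Hr)); unfold U; rewrite clamp_id by auto.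
    replace (exp (u r * / 2) ^ 2) with (exp (u r)).
    - rewrite exp_Ropp; field; apply Rgt_not_eq, exp_pos.
    - simpl; rewrite Rmult_1_r, <- exp_plus; f_equal; field. }
  (* Self-consistency: together with [Hm2] this becomes [2 * m * tan m = lambda]. *)
  assert (HJt : J = 1 * tan m / m).
  { unfold J; rewrite (RInt_ext _ (fun s => 1 / cos (m * s) ^ 2)).
    - apply is_RInt_unique, is_RInt_sec2; auto.
    - rewrite Rmin_left, Rmax_right by lra; intros x Hx; apply Hexp; unfold I01; lra. }
  repeat split; auto.
  - assert (Ht : tan m = m * J) by (rewrite HJt; field; lra).
    rewrite Ht; replace (2 * m * (m * J)) with (2 * m ^ 2 * J) by ring.
    rewrite Hm2; field; lra.
  - intros r Hr; assert (Hc := Hcos r Hr).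
    rewrite Hrho, <- Hm2, Hexp by auto; field; lra.
  - intros r Hr; destruct (HS r Hr) as [E1 E2]; assert (Hc := Hcos r Hr).
    rewrite E1 in E2; unfold V in E2; rewrite clamp_id in E2 by auto.
    unfold tan; apply Rmult_eq_reg_r with (cos (m * r)); [rewrite E2; field|]; lra.
Qed.

(** * Trigonometric bounds and the gap between the frequency and [PI / 2] *)

Lemma MVT_closed (f df : R -> R) (a b : R) :
  a <= b -> (forall x, a <= x <= b -> is_derive f x (df x)) ->
  exists c, a <= c <= b /\ f b - f a = df c * (b - a).
Proof.
  intros Hab Hd.
  destruct (MVT_gen f a b df) as [c Hc].
  - rewrite Rmin_left, Rmax_right by lra; intros x Hx; apply Hd; lra.
  - rewrite Rmin_left, Rmax_right by lra; intros x Hx.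
    apply continuity_pt_filterlim, (ex_derive_continuous f); eexists; apply Hd; lra.
  - rewrite Rmin_left, Rmax_right in Hc by lra; exists c; exact Hc.
Qed.

(** The mean value theorem gives [sin x = x * cos c] with [c <= x], and cosine decreases. *)
Lemma sin_ge_mul_cos (x : R) : 0 <= x <= PI / 2 -> x * cos x <= sin x.
Proof.
  intros Hx; assert (P := PI_RGT_0).
  destruct (MVT_closed sin cos 0 x) as [c [Hc E]]; [lra | intros; apply is_derive_sin |].
  rewrite sin_0 in E.
  assert (cos x <= cos c) by (apply cos_decr_1; lra).
  nra.
Qed.

(** Follows from [cos x = 1 - 2 * sin (x / 2) ^ 2] and [|sin t| <= |t|]. The latter is split at
    [|t| = 1]: below it the sign of [sin t] is known, as [1 < PI / 2], and above it [|sin t| <= 1]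
    suffices. *)
Lemma one_minus_cos_le (x : R) : 1 - x ^ 2 / 2 <= cos x.
Proof.
  assert (S : Rabs (sin (x / 2)) <= Rabs (x / 2)).
  { destruct (Rtotal_order (x / 2) 0) as [H | [-> | H]].
    - assert (T := sin_lt_x (- (x / 2))); rewrite sin_neg in T.
      assert (T' := SIN_bound (x / 2)).
      assert (T2 := PI2_1).
      unfold Rabs; repeat destruct Rcase_abs; try lra.
      assert (- (x / 2) < 1 \/ 1 <= - (x / 2)) as [|] by lra; [|lra].
      assert (sin (x / 2) < 0) by (apply sin_lt_0_var; lra); lra.
    - rewrite sin_0; lra.
    - assert (T := sin_lt_x (x / 2)).
      assert (T' := SIN_bound (x / 2)).
      assert (T2 := PI2_1).
      unfold Rabs; repeat destruct Rcase_abs; try lra.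
      assert (x / 2 < 1 \/ 1 <= x / 2) as [|] by lra; [|lra].
      assert (0 < sin (x / 2)) by (apply sin_gt_0; lra); lra. }
  replace x with (2 * (x / 2)) at 2 by field.
  rewrite cos_2a_sin.
  apply Rsqr_le_abs_1 in S; unfold Rsqr in S; nra.
Qed.

(** In terms of [d = PI / 2 - m] the dispersion relation reads
    [lambda * sin d = (PI - 2 * d) * cos d]. The bound [sin d >= d * cos d] gives the upper
    estimate; [sin d < d] and [cos d >= 1 - d ^ 2 / 2] give the lower one. *)
Lemma freq_gap (lambda m : R) :
  0 < lambda -> 0 < m < PI / 2 -> 2 * m * tan m = lambda ->
  lambda * (PI / 2 - m) <= PI /\
  (1 <= lambda -> Rabs (lambda * (PI / 2 - m) - PI) <= 40 / lambda).
Proof.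
  intros Hl Hm E; assert (P := PI_RGT_0); assert (P4 := PI_4).
  set (d := PI / 2 - m).
  assert (Hd : 0 < d < PI / 2) by (unfold d; lra).
  assert (Hs : 0 < sin d) by (apply sin_gt_0; lra).
  assert (Hc : 0 < cos d) by (apply cos_gt_0; lra).
  assert (E' : lambda * sin d = (PI - 2 * d) * cos d).
  { rewrite <- E; unfold tan; rewrite <- (sin_shift m), <- (cos_shift m); fold d.
    replace m with (PI / 2 - d) by (unfold d; ring). field; lra. }
  assert (U : lambda * d <= PI).
  { assert (T := sin_ge_mul_cos d ltac:(lra)).
    apply Rmult_le_reg_r with (cos d); auto. nra. }
  split; [exact U|]; intros Hl1.
  assert (S := sin_lt_x d (proj1 Hd)); assert (C := one_minus_cos_le d).
  assert (L : PI - 2 * d - PI * d ^ 2 / 2 <= lambda * d).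
  { assert (0 <= d ^ 3) by (apply pow_le; lra).
    assert ((PI - 2 * d) * (1 - d ^ 2 / 2) <= (PI - 2 * d) * cos d)
      by (apply Rmult_le_compat_l; lra).
    assert (lambda * sin d <= lambda * d) by (apply Rmult_le_compat_l; lra).
    nra. }
  (* With [PI <= 4] and [d ^ 2 <= 4 * d], the defect [2 * d + PI * d ^ 2 / 2] is at most [10 * d],
     hence at most [40 / lambda]. *)
  assert (D : d <= 4 / lambda) by (apply Rle_div_r; lra).
  assert (D2 : d * d <= 4 * d) by (apply Rmult_le_compat_r; lra).
  rewrite Rabs_left1 by lra.
  replace (40 / lambda) with (10 * (4 / lambda)) by (field; lra).
  nra.
Qed.

(** * Taylor expansion of the density in the frequency, uniform in [r] through the lower bound
    [c] *)

Section Expansion.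
Variables (r c : R).
Hypotheses (Hr : 0 <= r <= 1) (Hc : 0 < c)
  (Hcos : forall x, 0 <= x <= PI / 2 -> c <= cos (x * r)).

(* First and second derivatives in [x] of [2 * x ^ 2 / cos (x * r) ^ 2]. *)
Definition sec2_d1 (x : R) : R :=
  4 * x / cos (x * r) ^ 2 + 4 * x ^ 2 * r * sin (x * r) / cos (x * r) ^ 3.

Definition sec2_d2 (x : R) : R :=
  4 / cos (x * r) ^ 2 + 16 * x * r * sin (x * r) / cos (x * r) ^ 3 +
  4 * x ^ 2 * r ^ 2 / cos (x * r) ^ 2 +
  12 * x ^ 2 * r ^ 2 * sin (x * r) ^ 2 / cos (x * r) ^ 4.

Lemma is_derive_scaled_sec2 (x : R) :
  0 <= x <= PI / 2 -> is_derive (fun x => 2 * x ^ 2 / cos (x * r) ^ 2) x (sec2_d1 x).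
Proof.
  intros Hx; assert (C := Hcos x Hx); unfold sec2_d1; auto_derive.
  - apply (pow_nonzero _ 2); lra.
  - field; lra.
Qed.

Lemma is_derive_sec2_d1 (x : R) :
  0 <= x <= PI / 2 -> is_derive sec2_d1 x (sec2_d2 x).
Proof.
  intros Hx; assert (C := Hcos x Hx); unfold sec2_d1, sec2_d2; auto_derive.
  - repeat split; [apply (pow_nonzero _ 2) | apply (pow_nonzero _ 3)]; lra.
  - field; lra.
Qed.

(** Over the common denominator [k ^ 4], with [0 <= x * r <= 2], the four numerators are at most 4,
    32, 16 and 48 in absolute value, so 128 is ample. *)
Lemma sec2_d2_bound (x : R) : 0 <= x <= PI / 2 -> Rabs (sec2_d2 x) <= 128 / c ^ 4.
Proof.
  intros Hx; assert (C := Hcos x Hx); unfold sec2_d2; assert (P4 := PI_4).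
  assert (C1 : cos (x * r) <= 1) by apply COS_bound.
  assert (S := SIN_bound (x * r)).
  set (k := cos (x * r)) in *; set (s := sin (x * r)) in *.
  assert (Hk : 0 < k) by lra.
  assert (K2 : 0 < k ^ 2) by (apply pow_lt; lra).
  assert (K4 : 0 < k ^ 4) by (apply pow_lt; lra).
  assert (C4 : c ^ 4 <= k ^ 4) by (apply pow_incr; lra).
  assert (C40 : 0 < c ^ 4) by (apply pow_lt; lra).
  set (y := x * r) in *.
  assert (Hy : 0 <= y <= 2) by (unfold y; nra).
  set (N := 4 * k ^ 2 + 16 * y * s * k + 4 * y ^ 2 * k ^ 2 + 12 * y ^ 2 * s ^ 2).
  match goal with |- Rabs ?a <= _ => replace a with (N / k ^ 4) by (unfold N, y; field; lra) end.
  assert (HN : Rabs N <= 128).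
  { assert (Y2 : 0 <= y ^ 2 <= 4) by (split; nra).
    assert (S2 : 0 <= s ^ 2 <= 1) by (split; nra).
    assert (K2' : 0 <= k ^ 2 <= 1) by (split; nra).
    assert (A : 0 <= y ^ 2 * k ^ 2 <= 4) by (split; nra).
    assert (B : 0 <= y ^ 2 * s ^ 2 <= 4) by (split; nra).
    assert (D : -1 <= s * k <= 1) by (split; nra).
    assert (D' : - 2 <= y * (s * k) <= 2) by (split; nra).
    apply Rabs_le; unfold N; nra. }
  unfold Rdiv; rewrite Rabs_mult, (Rabs_pos_eq (/ k ^ 4)) by (apply Rlt_le, Rinv_0_lt_compat; lra).
  apply Rmult_le_compat; auto.
  - apply Rabs_pos.
  - apply Rlt_le, Rinv_0_lt_compat; lra.
  - apply Rinv_le_contravar; lra.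
Qed.

(** Two successive uses of the mean value theorem; losing the factor [1 / 2] of the Taylor remainder
    is harmless. *)
Lemma sec2_taylor (m : R) : 0 < m < PI / 2 ->
  Rabs (2 * (PI / 2) ^ 2 / cos (PI / 2 * r) ^ 2 - 2 * m ^ 2 / cos (m * r) ^ 2
        - (PI / 2 - m) * sec2_d1 (PI / 2)) <= 128 / c ^ 4 * (PI / 2 - m) ^ 2.
Proof.
  intros Hm.
  destruct (MVT_closed (fun x => 2 * x ^ 2 / cos (x * r) ^ 2) sec2_d1 m (PI / 2)) as [x [Hx E]].
  { lra. } { intros x Hx; apply is_derive_scaled_sec2; lra. }
  destruct (MVT_closed sec2_d1 sec2_d2 x (PI / 2)) as [y [Hy E']].
  { lra. } { intros y Hy; apply is_derive_sec2_d1; lra. }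
  cbv beta in E; rewrite E.
  match goal with |- Rabs ?a <= _ => replace a with (- sec2_d2 y * ((PI / 2 - x) * (PI / 2 - m)))
    by (replace (sec2_d1 (PI / 2)) with (sec2_d1 x + sec2_d2 y * (PI / 2 - x)) by lra; ring) end.
  assert (B := sec2_d2_bound y ltac:(lra)).
  rewrite Rabs_mult, Rabs_Ropp, <- Rsqr_pow2.
  apply Rmult_le_compat; auto; try apply Rabs_pos.
  rewrite Rabs_pos_eq by (apply Rmult_le_pos; lra).
  apply Rmult_le_compat_r; lra.
Qed.
End Expansion.

(** * Expansion on compact subsets of [[0,1)] *)

(** A compact set is closed, so some disc around [1] misses it. *)
Lemma compact_away_from_1 (K : R -> Prop) :
  compact K -> (forall r, K r -> 0 <= r < 1) ->
  exists b, 0 <= b < 1 /\ forall r, K r -> r <= b.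
Proof.
  intros HK Hr.
  destruct (compact_P2 K HK 1) as [d Hd].
  { intros H1; assert (H := Hr 1 H1); lra. }
  exists (Rmax 0 (1 - d)); split.
  - assert (0 < d) by apply cond_pos; unfold Rmax; destruct Rle_dec; lra.
  - intros r Kr; apply Rnot_lt_le; intros H; assert (B := Hr r Kr).
    apply (Hd r); auto; unfold disc.
    assert (M := Rmax_r 0 (1 - d)); rewrite Rabs_left; lra.
Qed.

Lemma rho_interior_expansion (u du ddu : R -> R -> R) (K : R -> Prop) :
  (forall lambda, 0 < lambda ->
     is_solution lambda (u lambda) (du lambda) (ddu lambda)) ->
  compact K -> (forall r, K r -> 0 <= r < 1) ->
  exists o : R -> R -> R, unif_vanishing K o /\
    forall lambda r, 0 < lambda -> K r ->
      rho lambda (u lambda) r =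
        PI ^ 2 / 2 * sec (PI / 2 * r) ^ 2
        - 1 / lambda *
          (2 * PI ^ 2 * sec (PI / 2 * r) ^ 2
           + PI ^ 3 * r * sec (PI / 2 * r) ^ 2 * tan (PI / 2 * r))
          * (1 + o lambda r).
Proof.
  intros Hu HK HK1; assert (P := PI_RGT_0).
  destruct (compact_away_from_1 K HK HK1) as [b [Hb Kb]].
  assert (Pb : 0 <= PI / 2 * b < PI / 2) by (split; nra).
  set (c := cos (PI / 2 * b)).
  assert (Hc : 0 < c) by (apply cos_gt_0; lra).
  assert (Hcos : forall r, K r -> forall x, 0 <= x <= PI / 2 -> c <= cos (x * r)).
  { intros r Kr x Hx; assert (B := HK1 r Kr); assert (B' := Kb r Kr).
    assert (0 <= x * r) by nra.
    assert (x * r <= PI / 2 * b) by (apply Rmult_le_compat; lra).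
    apply cos_decr_1; lra. }
  (* To first order the density drops by [(PI / 2 - m) * sec2_d1 r (PI / 2)], and [PI / 2 - m] is
     close to [PI / lambda]; hence [T] is the bracket in the claim. *)
  set (T := fun r => PI * sec2_d1 r (PI / 2)).
  assert (HT : forall r, K r -> T r = 2 * PI ^ 2 * sec (PI / 2 * r) ^ 2
           + PI ^ 3 * r * sec (PI / 2 * r) ^ 2 * tan (PI / 2 * r)).
  { intros r Kr; assert (C := Hcos r Kr (PI / 2) ltac:(lra)).
    unfold T, sec2_d1, sec, tan; field; lra. }
  assert (T0 : forall r, K r -> 2 * PI ^ 2 <= T r).
  { intros r Kr; rewrite HT by auto; assert (B := HK1 r Kr).
    assert (C := Hcos r Kr (PI / 2) ltac:(lra)).
    assert (S : 1 <= sec (PI / 2 * r)).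
    { unfold sec; rewrite <- Rinv_1; apply Rinv_le_contravar; [lra | apply COS_bound]. }
    assert (0 <= tan (PI / 2 * r)).
    { unfold tan; apply Rmult_le_pos; [apply sin_ge_0; nra | apply Rlt_le, Rinv_0_lt_compat; lra]. }
    assert (S2 : 1 <= sec (PI / 2 * r) ^ 2) by nra.
    assert (0 <= PI ^ 3) by (apply pow_le; lra).
    assert (0 <= PI ^ 3 * r * sec (PI / 2 * r) ^ 2 * tan (PI / 2 * r)).
    { apply Rmult_le_pos; [|assumption]; apply Rmult_le_pos; [|lra].
      apply Rmult_le_pos; lra. }
    assert (0 <= PI ^ 2) by (apply pow_le; lra).
    nra. }
  (* The expansion solved for its error term; dividing is legitimate because [T r >= 2 * PI ^ 2]. *)
  exists (fun lambda r =>
    lambda * (PI ^ 2 / 2 * sec (PI / 2 * r) ^ 2 - rho lambda (u lambda) r) / T r - 1).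
  split.
  - set (M := 128 / c ^ 4).
    assert (HM : 0 < M) by (apply Rdiv_lt_0_compat; [lra | apply pow_lt; auto]).
    intros e He; exists (Rmax 1 ((M + 40) / e)); intros l Hl r Kr.
    assert (Hl1 := Rmax_l 1 ((M + 40) / e)); assert (Hl2 := Rmax_r 1 ((M + 40) / e)).
    destruct (solution_formula l _ _ _ ltac:(lra) (Hu l ltac:(lra))) as [Hm [Hlm [Hrho _]]].
    set (m := freq l (u l)) in *.
    destruct (freq_gap l m ltac:(lra) Hm Hlm) as [G1 G2]; specialize (G2 ltac:(lra)).
    assert (B := HK1 r Kr).
    rewrite Hrho by (unfold I01; lra).
    assert (Ty := sec2_taylor r c ltac:(lra) Hc (Hcos r Kr) m Hm).
    assert (C := Hcos r Kr (PI / 2) ltac:(lra)).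
    assert (Tr := T0 r Kr).
    fold M in Ty.
    replace (2 * (PI / 2) ^ 2 / cos (PI / 2 * r) ^ 2)
      with (PI ^ 2 / 2 * sec (PI / 2 * r) ^ 2) in Ty by (unfold sec; field; lra).
    set (D := PI ^ 2 / 2 * sec (PI / 2 * r) ^ 2 - 2 * m ^ 2 / cos (m * r) ^ 2) in *.
    set (d := PI / 2 - m) in *.
    assert (P2 : 0 < PI ^ 2) by (apply pow_lt; lra).
    assert (S0 : sec2_d1 r (PI / 2) <> 0)
      by (unfold T in Tr; intros Z; rewrite Z in Tr; lra).
    (* The error splits into the Taylor remainder, at most [M / l], and the error of the gap, at
       most [40 / l]; this explains the threshold [(M + 40) / e]. *)
    replace (l * D / T r - 1)
      with (l * (D - d * sec2_d1 r (PI / 2)) / T r + (l * d - PI) / PI)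
      by (unfold T; field; lra).
    apply Rle_lt_trans with (1 := Rabs_triang _ _).
    assert (L : (M + 40) / l < e).
    { apply Rlt_div_l; [lra|].
      assert ((M + 40) / e < l) as H by lra; apply Rlt_div_l in H; lra. }
    apply Rle_lt_trans with (2 := L).
    replace ((M + 40) / l) with (M / l + 40 / l) by (field; lra).
    apply Rplus_le_compat.
    + unfold Rdiv; rewrite !Rabs_mult, (Rabs_pos_eq l), (Rabs_pos_eq (/ T r))
        by (try apply Rlt_le, Rinv_0_lt_compat; lra).
      apply Rle_div_l; [lra|].
      (* Here [l * d <= PI] turns the quadratic remainder into a bound of order [1 / l ^ 2]. *)
      assert (X : M * d ^ 2 * (l * l) <= M * PI ^ 2).
      { rewrite Rmult_assoc; apply Rmult_le_compat_l; [lra|].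
        replace (d ^ 2 * (l * l)) with ((l * d) ^ 2) by ring.
        apply pow_incr; split; [|lra]. apply Rmult_le_pos; unfold d; lra. }
      replace (M * / l * T r) with (M * T r / l) by (field; lra).
      apply (Rle_div_r _ _ l); [lra|].
      assert (l * l * Rabs (D - d * sec2_d1 r (PI / 2)) <= l * l * (M * d ^ 2))
        by (apply Rmult_le_compat_l; [nra | assumption]).
      assert (M * (2 * PI ^ 2) <= M * T r) by (apply Rmult_le_compat_l; lra).
      assert (0 < M * PI ^ 2) by (apply Rmult_lt_0_compat; lra).
      nra.
    + unfold Rdiv at 1; rewrite Rabs_mult, (Rabs_pos_eq (/ PI))
        by (apply Rlt_le, Rinv_0_lt_compat; lra).
      apply Rle_div_l; [lra|].
      assert (1 <= PI) by (assert (Q := PI2_1); lra).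
      assert (0 <= 40 / l) by (apply Rlt_le, Rdiv_lt_0_compat; lra).
      nra.
  - intros l r Hl Kr; rewrite <- HT by auto.
    assert (Tr := T0 r Kr); assert (P2 : 0 < PI ^ 2) by (apply pow_lt; lra).
    field; split; lra.
Qed.

(** * Limits at infinity and the boundary layer near [1] *)

Lemma is_lim_of_inv_bound (f : R -> R) (l C : R) :
  0 < C -> (forall x, 1 <= x -> Rabs (f x - l) <= C / x) -> is_lim f p_infty l.
Proof.
  intros HC H; apply is_lim_spec; intros e.
  assert (He := cond_pos e).
  exists (Rmax 1 (C / e)); intros x Hx.
  assert (H1 := Rmax_l 1 (C / e)); assert (H2 := Rmax_r 1 (C / e)).
  apply Rle_lt_trans with (1 := H x ltac:(lra)).
  apply Rlt_div_l; [lra|]. rewrite Rmult_comm; apply Rlt_div_l; lra.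
Qed.

Lemma is_lim_mult_finite (f g : R -> R) (x : Rbar) (lf lg : R) :
  is_lim f x lf -> is_lim g x lg -> is_lim (fun y => f y * g y) x (lf * lg).
Proof.
  intros Hf Hg; exact (is_lim_mult f g x lf lg Hf Hg I).
Qed.

Lemma is_lim_Rpower_neg (a : R) : a < 0 -> is_lim (fun x => Rpower x a) p_infty 0.
Proof.
  intros Ha; apply is_lim_spec; intros e; assert (He := cond_pos e).
  (* The threshold solves [Rpower x a = e]. *)
  exists (exp (ln e / a)); intros x Hx; rewrite Rminus_0_r.
  unfold Rpower; rewrite Rabs_pos_eq by apply Rlt_le, exp_pos.
  rewrite <- (exp_ln e) by assumption; apply exp_increasing.
  apply ln_increasing in Hx; [|apply exp_pos]; rewrite ln_exp in Hx.
  replace (ln e) with (a * (ln e / a)) by (field; lra).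
  nra.
Qed.

Section Family.
Variables (u du ddu : R -> R -> R).
Hypothesis Hu : forall lambda, 0 < lambda ->
  is_solution lambda (u lambda) (du lambda) (ddu lambda).

Lemma is_lim_gap_scaled :
  is_lim (fun l => l * (PI / 2 - freq l (u l))) p_infty PI.
Proof.
  apply is_lim_of_inv_bound with 40; [lra|]; intros l Hl.
  destruct (solution_formula l _ _ _ ltac:(lra) (Hu l ltac:(lra))) as [Hm [Hlm _]].
  apply (freq_gap l _ ltac:(lra) Hm Hlm); lra.
Qed.

Lemma is_lim_freq : is_lim (fun l => freq l (u l)) p_infty (PI / 2).
Proof.
  apply is_lim_of_inv_bound with PI; [apply PI_RGT_0|]; intros l Hl.
  destruct (solution_formula l _ _ _ ltac:(lra) (Hu l ltac:(lra))) as [Hm [Hlm _]].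
  destruct (freq_gap l _ ltac:(lra) Hm Hlm) as [H _].
  rewrite Rabs_left by lra; apply Rle_div_r; lra.
Qed.

(** With [th = PI / 2 - m * r] the density is [2 * m ^ 2 / sin th ^ 2]. If [L * th] tends to [k],
    then [sin th] behaves like [k / L], while [m] tends to [PI / 2]; this yields [lead] for every
    scale [L]. *)
Lemma rho_boundary_layer (p alpha k : R) (L lead : R -> R) :
  0 < p -> 0 < alpha -> 0 < k ->
  (forall l, 0 < l -> 0 < L l) ->
  (forall l, 0 < l -> lead l = PI ^ 2 / (2 * k ^ 2) * L l ^ 2) ->
  is_lim (fun l => L l * (PI / 2 - freq l (u l) * (1 - p / Rpower l alpha))) p_infty k ->
  exists o, vanishing o /\
    forall l, 0 < l -> rho l (u l) (1 - p / Rpower l alpha) = lead l * (1 + o l).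
Proof.
  intros Hp Ha Hk HL Hlead Hlim; assert (P := PI_RGT_0).
  assert (P2 : 0 < PI ^ 2) by (apply pow_lt; lra).
  assert (K2 : 0 < k ^ 2) by (apply pow_lt; lra).
  set (r := fun l => 1 - p / Rpower l alpha).
  set (th := fun l => PI / 2 - freq l (u l) * r l).
  set (y := fun t => sin t / t).
  exists (fun l => rho l (u l) (r l) / lead l - 1); split.
  2: { intros l Hl; unfold r; assert (H := HL l Hl).
       assert (0 < lead l).
       { rewrite Hlead by auto; apply Rmult_lt_0_compat; [|apply pow_lt; auto].
         apply Rdiv_lt_0_compat; lra. }
       field; lra. }
  assert (Hr1 : is_lim (fun l => / Rpower l alpha) p_infty 0).
  { apply is_lim_ext with (fun l => Rpower l (- alpha)).
    - intros l; apply Rpower_Ropp.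
    - apply is_lim_Rpower_neg; lra. }
  assert (Hr : is_lim r p_infty (1 - p * 0)).
  { apply is_lim_minus'; [apply is_lim_const|].
    apply (is_lim_scal_l _ p p_infty 0), Hr1. }
  assert (Hth : is_lim th p_infty 0).
  { replace 0 with (PI / 2 - PI / 2 * (1 - p * 0)) by ring.
    apply is_lim_minus'; [apply is_lim_const|].
    apply is_lim_mult_finite; [apply is_lim_freq | exact Hr]. }
  (* Positivity of [th] keeps the composition away from [0], where [y] takes the value [0] and not
     its limit [1]. *)
  assert (Hev : Rbar_locally' p_infty (fun l => 0 < l /\ I01 (r l) /\ 0 < th l)).
  { apply is_lim_spec in Hr1; assert (Hp' : 0 < / p) by (apply Rinv_0_lt_compat; lra).
    destruct (Hr1 (mkposreal _ Hp')) as [N HN].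
    exists (Rmax 0 N); intros l Hl; simpl in HN.
    assert (H1 := Rmax_l 0 N); assert (H2 := Rmax_r 0 N).
    specialize (HN l ltac:(lra)); rewrite Rminus_0_r in HN.
    assert (Q : 0 < / Rpower l alpha) by apply Rinv_0_lt_compat, exp_pos.
    rewrite Rabs_pos_eq in HN by lra.
    assert (R1 : 0 < p / Rpower l alpha < 1).
    { unfold Rdiv; split; [nra|].
      apply (Rmult_lt_compat_l p) in HN; [|lra]; rewrite Rinv_r in HN; lra. }
    destruct (solution_formula l _ _ _ ltac:(lra) (Hu l ltac:(lra))) as [Hm _].
    unfold th, r, I01; repeat split; try lra; nra. }
  assert (Hy : is_lim (fun l => y (th l)) p_infty 1).
  { apply is_lim_comp with 0; [apply is_lim_sinc_0 | exact Hth |].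
    revert Hev; apply filter_imp.
    intros l [_ [_ H]] E; injection E; lra. }
  unfold vanishing.
  (* Gives the limit the shape of the quotient below, in which the factors [L l] coming from [lead]
     are grouped with [th l]. *)
  replace 0 with (2 * ((PI / 2) * (PI / 2)) * / (1 * 1 * (k * k)) / (PI ^ 2 / (2 * k ^ 2)) - 1)
    by (field; lra).
  apply is_lim_ext_loc with (fun l =>
    2 * (freq l (u l) * freq l (u l)) * / (y (th l) * y (th l) * ((L l * th l) * (L l * th l)))
    * / (PI ^ 2 / (2 * k ^ 2)) - 1).
  - revert Hev; apply filter_imp; intros l [Hl [H1 H2]].
    destruct (solution_formula l _ _ _ Hl (Hu l Hl)) as [Hm [_ [Hrho _]]].
    rewrite Hrho by auto.
    replace (cos (freq l (u l) * r l)) with (sin (th l)) by (unfold th; apply sin_shift).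
    rewrite Hlead by auto.
    assert (HLl := HL l Hl).
    assert (th l <= PI / 2) by (unfold th; unfold I01 in H1; nra).
    assert (0 < sin (th l)) by (apply sin_gt_0; lra).
    unfold y; field; lra.
  - apply is_lim_minus'; [|apply is_lim_const].
    apply is_lim_mult_finite; [|apply is_lim_const].
    apply is_lim_mult_finite.
    + apply is_lim_mult_finite; [apply is_lim_const|]; apply is_lim_mult_finite; apply is_lim_freq.
    + assert (N : Finite (1 * 1 * (k * k)) <> 0) by (intros E; injection E; nra).
      refine (is_lim_inv _ _ _ _ N).
      repeat apply is_lim_mult_finite; assumption.
Qed.

Lemma rho_near_boundary (p alpha : R) : 0 < p -> 0 < alpha ->
  exists o : R -> R, vanishing o /\
    forall lambda, 0 < lambda ->
      let r := 1 - p / Rpower lambda alpha in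
      0 < r < 1 ->
      (1 < alpha -> rho lambda (u lambda) r = lambda ^ 2 / 2 * (1 + o lambda)) /\
      (alpha = 1 ->
         rho lambda (u lambda) r = 2 * lambda ^ 2 / (p + 2) ^ 2 * (1 + o lambda)) /\
      (alpha < 1 ->
         rho lambda (u lambda) r
         = 2 * Rpower lambda (2 * alpha) / p ^ 2 * (1 + o lambda)).
Proof.
  intros Hp Ha; assert (P := PI_RGT_0).
  assert (Hpos : Rbar_locally' p_infty (fun l => 0 < l)) by (exists 0; auto).
  assert (Hinv : forall l a, / Rpower l a = Rpower l (- a))
    by (intros; symmetry; apply Rpower_Ropp).
  (* The regime is fixed before the error term is chosen, so the other two implications hold
     vacuously. *)
  destruct (Rtotal_order alpha 1) as [H | [H | H]].
  (* On the scale [l ^ alpha] the contribution of the gap vanishes and only [m * p] survives. *)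
  - destruct (rho_boundary_layer p alpha (PI / 2 * p) (fun l => Rpower l alpha)
      (fun l => 2 * Rpower l (2 * alpha) / p ^ 2)) as [o [Ho E]]; auto.
    + nra.
    + intros; apply exp_pos.
    + intros l Hl; replace (2 * alpha) with (alpha + alpha) by ring.
      rewrite Rpower_plus; field; lra.
    + replace (PI / 2 * p) with (PI * 0 + PI / 2 * p) by ring.
      apply is_lim_ext_loc with (fun l =>
        l * (PI / 2 - freq l (u l)) * Rpower l (alpha - 1) + freq l (u l) * p).
      * revert Hpos; apply filter_imp; intros l Hl.
        unfold Rminus at 2; rewrite Rpower_plus, Rpower_Ropp, Rpower_1 by auto.
        assert (0 < Rpower l alpha) by apply exp_pos.
        field; lra.
      * apply is_lim_plus'; apply is_lim_mult_finite.
        -- apply is_lim_gap_scaled.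
        -- apply is_lim_Rpower_neg; lra.
        -- apply is_lim_freq.
        -- apply is_lim_const.
    + exists o; split; auto; intros l Hl r Hr; repeat split; intros; try lra; apply E; auto.
  (* Both contributions have order [1 / l]; the limit is [PI / 2 * (p + 2)]. *)
  - destruct (rho_boundary_layer p alpha (PI + PI / 2 * p) (fun l => l)
      (fun l => 2 * l ^ 2 / (p + 2) ^ 2)) as [o [Ho E]]; auto.
    + nra.
    + intros l Hl; field; repeat split; nra.
    + apply is_lim_ext_loc with (fun l =>
        l * (PI / 2 - freq l (u l)) + freq l (u l) * p).
      * revert Hpos; apply filter_imp; intros l Hl.
        rewrite H, Rpower_1 by auto; field; lra.
      * apply is_lim_plus'; [apply is_lim_gap_scaled | apply is_lim_mult_finite].
        -- apply is_lim_freq.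
        -- apply is_lim_const.
    + exists o; split; auto; intros l Hl r Hr; repeat split; intros; try lra; apply E; auto.
  (* On the scale [l] the distance to the boundary vanishes and only the gap survives. *)
  - destruct (rho_boundary_layer p alpha PI (fun l => l)
      (fun l => l ^ 2 / 2)) as [o [Ho E]]; auto.
    + intros l Hl; field; lra.
    + replace (Finite PI) with (Finite (PI + PI / 2 * p * 0)) by (f_equal; ring).
      apply is_lim_ext_loc with (fun l =>
        l * (PI / 2 - freq l (u l)) + freq l (u l) * p * Rpower l (1 - alpha)).
      * revert Hpos; apply filter_imp; intros l Hl.
        unfold Rminus at 2; rewrite Rpower_plus, Rpower_Ropp, Rpower_1 by auto.
        assert (0 < Rpower l alpha) by apply exp_pos.
        field; lra.
      * apply is_lim_plus'; [apply is_lim_gap_scaled | apply is_lim_mult_finite; [apply is_lim_mult_finite|]].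
        -- apply is_lim_freq.
        -- apply is_lim_const.
        -- apply is_lim_Rpower_neg; lra.
    + exists o; split; auto; intros l Hl r Hr; repeat split; intros; try lra; apply E; auto.
Qed.

(** * Concentration at [1] against continuous test functions *)

Variable h : R -> R.
Hypothesis Hh : continuous_on I01 h.

Let H (r : R) : R := h (clamp r).

Let continuous_H (r : R) : continuous H r := continuous_clamp h r Hh.

Let H_bounded : exists B, 0 < B /\ forall r, I01 r -> Rabs (H r - H 1) <= B.
Proof.
  destruct (continuity_ab_maj (fun r => Rabs (H r - H 1)) 0 1) as [x [Hx _]]; [lra| |].
  - intros c _; apply continuity_pt_filterlim.
    apply (continuous_comp (fun r => H r - H 1) Rabs); [|apply continuous_Rabs].
    cont.
  - exists (Rabs (H x - H 1) + 1); split; [assert (T := Rabs_pos (H x - H 1)); lra|].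
    intros r Hr; specialize (Hx r Hr); lra.
Qed.

(** Unit mass is the dispersion relation divided by [l]. *)
Lemma is_RInt_density (l : R) : 0 < l ->
  let m := freq l (u l) in
  is_RInt (fun r => 2 * m ^ 2 / l / cos (m * r) ^ 2) 0 1 1.
Proof.
  intros Hl m.
  destruct (solution_formula l _ _ _ Hl (Hu l Hl)) as [Hm [Hlm _]]; fold m in Hm, Hlm.
  replace 1 with (2 * m ^ 2 / l * tan m / m) at 2; [now apply is_RInt_sec2|].
  apply Rmult_eq_reg_r with l; [|lra]; rewrite <- Hlm at 3; field; lra.
Qed.

(** Approximate identity argument: near [1] the oscillation of [h] is small and the mass is [1];
    away from [1] the density is [O(1 / l)] and [h] is bounded. *)
Lemma density_concentrates :
  is_lim (fun l => RInt (fun r => rho l (u l) r / l * h r) 0 1) p_infty (h 1).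
Proof.
  assert (P := PI_RGT_0); assert (P4 := PI_4).
  destruct H_bounded as [B [HB HB']].
  assert (H1 : H 1 = h 1) by (unfold H; rewrite clamp_id; auto; unfold I01; lra).
  apply is_lim_spec; intros e; assert (He := cond_pos e).
  assert (He2 : 0 < e / 2) by lra.
  destruct (proj1 (filterlim_locally H (H 1)) (continuous_H 1) (mkposreal _ He2)) as [d Hd].
  assert (Hd' : forall r, 1 - d < r <= 1 -> Rabs (H r - H 1) <= e / 2).
  { intros r Hr; apply Rlt_le, (Hd r).
    change (Rabs (r - 1) < d); rewrite Rabs_left1; lra. }
  assert (Dp := cond_pos d).
  set (b := Rmax 0 (1 - d)).
  assert (Hb : 0 <= b < 1) by (unfold b, Rmax; destruct Rle_dec; lra).
  assert (Hb' : 1 - d <= b) by apply Rmax_r.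
  assert (Hc : 0 < cos (PI / 2 * b)) by (apply cos_gt_0; nra).
  (* The [8] bounds [2 * m ^ 2], since [m < PI / 2 <= 2]. *)
  set (C := B * (8 / cos (PI / 2 * b) ^ 2)).
  assert (HC : 0 < C).
  { apply Rmult_lt_0_compat; [lra|]; apply Rdiv_lt_0_compat; [lra | apply pow_lt; auto]. }
  exists (4 * C / e); intros l Hl.
  assert (Hl0 : 0 < l) by (assert (0 < 4 * C / e) by (apply Rdiv_lt_0_compat; lra); lra).
  destruct (solution_formula l _ _ _ Hl0 (Hu l Hl0)) as [Hm [Hlm [Hrho _]]].
  set (m := freq l (u l)) in *.
  set (G := fun r => 2 * m ^ 2 / l / cos (m * r) ^ 2).
  assert (IG : is_RInt G 0 1 1) by (apply is_RInt_density; auto).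
  assert (G0 : forall r, I01 r -> 0 <= G r).
  { intros r Hr; assert (Q := cos_pos_lt_PI2 m r Hm Hr).
    apply Rlt_le, Rdiv_lt_0_compat; [apply Rdiv_lt_0_compat; nra | apply pow_lt; auto]. }
  assert (EGH : ex_RInt (fun r => G r * (H r - H 1)) 0 1).
  { apply (ex_RInt_continuous (fun r => G r * (H r - H 1))); rewrite Rmin_left, Rmax_right by lra.
    intros r Hr; apply (@continuous_mult _ R_AbsRing G); [|cont].
    apply continuous_sec2, Rgt_not_eq, cos_pos_lt_PI2; auto. }
  assert (E : RInt (fun r => rho l (u l) r / l * h r) 0 1
              = RInt (fun r => G r * (H r - H 1)) 0 1 + h 1).
  { apply is_RInt_unique.
    apply is_RInt_ext with (fun r => plus (G r * (H r - H 1)) (scal (h 1) (G r))).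
    - rewrite Rmin_left, Rmax_right by lra; intros r Hr.
      assert (Ir : I01 r) by (unfold I01; lra).
      assert (Q := cos_pos_lt_PI2 m r Hm Ir).
      rewrite Hrho, H1 by auto; unfold H, G; rewrite clamp_id by auto.
      unfold plus, scal; simpl; unfold mult; simpl; field; lra.
    - replace (RInt (fun r => G r * (H r - H 1)) 0 1 + h 1)
        with (plus (RInt (fun r => G r * (H r - H 1)) 0 1) (scal (h 1) 1))
        by (unfold plus, scal; simpl; unfold mult; simpl; ring).
      apply (is_RInt_plus (V := R_NormedModule)); [apply (RInt_correct (V := R_CompleteNormedModule)), EGH |].
      apply (is_RInt_scal (V := R_NormedModule)), IG. }
  rewrite E, Rplus_minus_r.
  apply Rle_lt_trans with (e / 2 * 1 + (1 - 0) * (C / l)).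
  (* A single majorant valid on both sides of [b] avoids cutting the integral there. *)
  - apply (norm_RInt_le (fun r => G r * (H r - H 1)) (fun r => plus (scal (e / 2) (G r)) (C / l)) 0 1).
    + lra.
    + intros r Hr; assert (Q := cos_pos_lt_PI2 m r Hm Hr); assert (Gr := G0 r Hr).
      change (Rabs (G r * (H r - H 1)) <= e / 2 * G r + C / l).
      rewrite Rabs_mult, (Rabs_pos_eq (G r)) by auto.
      assert (0 < C / l) by (apply Rdiv_lt_0_compat; lra).
      destruct (Rle_lt_dec r b) as [Hrb | Hrb].
      * assert (G r * Rabs (H r - H 1) <= C / l); [|nra].
        replace (C / l) with (8 / l / cos (PI / 2 * b) ^ 2 * B) by (unfold C; field; lra).
        apply Rmult_le_compat; auto; [apply Rabs_pos|].
        unfold G; apply Rmult_le_compat.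
        -- apply Rlt_le, Rdiv_lt_0_compat; nra.
        -- apply Rlt_le, Rinv_0_lt_compat, pow_lt; auto.
        -- apply Rmult_le_compat_r; [apply Rlt_le, Rinv_0_lt_compat; auto | nra].
        -- apply Rinv_le_contravar; [apply pow_lt; auto|].
           apply pow_incr; split; [lra|].
           assert (0 <= m * r) by nra.
           assert (m * r <= PI / 2 * b) by (apply Rmult_le_compat; lra).
           apply cos_decr_1; nra.
      * assert (T := Hd' r ltac:(lra)).
        assert (G r * Rabs (H r - H 1) <= G r * (e / 2)) by (apply Rmult_le_compat_l; auto).
        lra.
    + apply (RInt_correct (V := R_CompleteNormedModule)), EGH.
    + apply (is_RInt_plus (V := R_NormedModule)); [apply (is_RInt_scal (V := R_NormedModule)), IG |].
      apply (is_RInt_const (V := R_NormedModule)).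
  - assert (C / l < e / 4); [|lra].
    apply Rlt_div_l; [lra|].
    assert (4 * C < l * e) by (apply Rlt_div_l; lra). lra.
Qed.

(** As [tan ^ 2 = sec ^ 2 - 1], the energy density is [rho / l - 2 * m ^ 2 / l], and the subtracted
    term vanishes in the limit because [m] stays bounded. *)
Lemma energy_concentrates :
  is_lim (fun l => RInt (fun r => du l r ^ 2 / (2 * l) * h r) 0 1) p_infty (h 1).
Proof.
  set (m := fun l => freq l (u l)).
  assert (EH : ex_RInt H 0 1).
  { apply (ex_RInt_continuous H); intros; apply continuous_H. }
  apply is_lim_ext_loc with (fun l =>
    RInt (fun r => rho l (u l) r / l * h r) 0 1 - 2 * (m l * m l) * / l * RInt H 0 1).
  - exists 0; intros l Hl.
    destruct (solution_formula l _ _ _ Hl (Hu l Hl)) as [Hm [_ [Hrho Hdu]]].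
    fold (m l) in Hm, Hrho, Hdu.
    set (S := fun r => rho l (u l) r / l * h r).
    assert (ES : ex_RInt S 0 1).
    { apply ex_RInt_ext with (fun r => 2 * m l ^ 2 / l / cos (m l * r) ^ 2 * H r).
      - rewrite Rmin_left, Rmax_right by lra; intros r Hr; unfold S.
        assert (Ir : I01 r) by (unfold I01; lra).
        assert (Q := cos_pos_lt_PI2 (m l) r Hm Ir).
        rewrite Hrho by auto; unfold H; rewrite clamp_id by auto.
        match goal with |- ?a = ?b => change (@eq R a b) end; field; lra.
      - apply (ex_RInt_continuous (fun r => 2 * m l ^ 2 / l / cos (m l * r) ^ 2 * H r)).
        rewrite Rmin_left, Rmax_right by lra; intros r Hr.
        apply (@continuous_mult _ R_AbsRing (fun r => 2 * m l ^ 2 / l / cos (m l * r) ^ 2));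
          [|apply continuous_H].
        apply continuous_sec2, Rgt_not_eq, cos_pos_lt_PI2; auto. }
    symmetry; apply is_RInt_unique.
    apply is_RInt_ext with (fun r => minus (S r) (scal (2 * (m l * m l) * / l) (H r))).
    + rewrite Rmin_left, Rmax_right by lra; intros r Hr.
      assert (Ir : I01 r) by (unfold I01; lra).
      assert (Q := cos_pos_lt_PI2 (m l) r Hm Ir).
      unfold S; rewrite Hrho, Hdu by auto; unfold H; rewrite clamp_id by auto.
      assert (T := sin2_cos2 (m l * r)); unfold Rsqr in T.
      change (2 * m l ^ 2 / cos (m l * r) ^ 2 / l * h r - 2 * (m l * m l) * / l * h r
        = (- (2 * m l * tan (m l * r))) ^ 2 / (2 * l) * h r).
      replace (2 * m l ^ 2 / cos (m l * r) ^ 2)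
        with (2 * m l ^ 2 * (sin (m l * r) * sin (m l * r) + cos (m l * r) * cos (m l * r))
              / cos (m l * r) ^ 2) by (rewrite T; field; lra).
      unfold tan; field; lra.
    + apply (is_RInt_minus (V := R_NormedModule)); [apply (RInt_correct (V := R_CompleteNormedModule)), ES |].
      apply (is_RInt_scal (V := R_NormedModule)), (RInt_correct (V := R_CompleteNormedModule)), EH.
  - generalize (RInt H 0 1 : R); intros J.
    replace (h 1) with (h 1 - 2 * ((PI / 2) * (PI / 2)) * 0 * J) by ring.
    apply is_lim_minus'; [apply density_concentrates|].
    apply is_lim_mult_finite; [|apply is_lim_const].
    apply is_lim_mult_finite.
    + apply is_lim_mult_finite; [apply is_lim_const|].
      apply is_lim_mult_finite; apply is_lim_freq.
    + apply (is_lim_inv (fun l => l) p_infty p_infty); [apply is_lim_id | discriminate].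
Qed.
End Family.

Theorem corollary2p3 (u du ddu : R -> R -> R)
  (Hu : forall lambda, 0 < lambda ->
          is_solution lambda (u lambda) (du lambda) (ddu lambda)) :
  (* (a) *)
  (forall K : R -> Prop, compact K -> (forall r, K r -> 0 <= r < 1) ->
     exists o : R -> R -> R, unif_vanishing K o /\
       forall lambda r, 0 < lambda -> K r ->
         rho lambda (u lambda) r =
           PI ^ 2 / 2 * sec (PI / 2 * r) ^ 2
           - 1 / lambda *
             (2 * PI ^ 2 * sec (PI / 2 * r) ^ 2
              + PI ^ 3 * r * sec (PI / 2 * r) ^ 2 * tan (PI / 2 * r))
             * (1 + o lambda r)) /\
  (* (b) *)
  (forall p alpha : R, 0 < p -> 0 < alpha ->
     exists o : R -> R, vanishing o /\
       forall lambda, 0 < lambda ->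
         let r := 1 - p / Rpower lambda alpha in
         0 < r < 1 ->
         (1 < alpha ->
            rho lambda (u lambda) r = lambda ^ 2 / 2 * (1 + o lambda)) /\
         (alpha = 1 ->
            rho lambda (u lambda) r = 2 * lambda ^ 2 / (p + 2) ^ 2 * (1 + o lambda)) /\
         (alpha < 1 ->
            rho lambda (u lambda) r
            = 2 * Rpower lambda (2 * alpha) / p ^ 2 * (1 + o lambda))) /\
  (* (c) *)
  (forall h : R -> R, continuous_on I01 h ->
     is_lim (fun lambda => RInt (fun r => rho lambda (u lambda) r / lambda * h r) 0 1)
       p_infty (h 1) /\
     is_lim (fun lambda => RInt (fun r => du lambda r ^ 2 / (2 * lambda) * h r) 0 1)
       p_infty (h 1)).
Proof.
  split; [|split].
  - intros K; exact (rho_interior_expansion u du ddu K Hu).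
  - exact (rho_near_boundary u du ddu Hu).
  - intros h Hh; split.
    + exact (density_concentrates u du ddu Hu h Hh).
    + exact (energy_concentrates u du ddu Hu h Hh).
Qed.
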